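(* Let $D>0$, $N\ge 0$, and let $(x_i,f_i,g_i)_{i=0}^N$ with $x_i,g_i\in\mathbb{R}^d$, $f_i\in\mathbb{R}$ be first-order information consistent with some convex function on $\mathbb{R}^d$ possessing a minimizer at distance at most $D$ from $x_0$. Let $$r_\star=\max_{x_\star\in\mathbb{R}^d,\ f_\star\in\mathbb{R}}\Big\{ f_N-f_\star \ :\ D^2-\|x_0-x_\star\|^2\ge 0,\ \ f_\star-f_i-\langle g_i,x_\star-x_i\rangle\ge 0,\ \ f_i-f_\star\ge 0\ \ \forall i=0,\dots,N\Big\}.$$ Then there exist nonnegative weights $a_0,\dots,a_N$ with $\sum_{i=0}^N a_i=1$ such that, setting $$\alpha(x)=\sum_{i=0}^N a_i\big(f_i+\langle g_i,x-x_i\rangle\big),$$ the following holds for every convex function $f:\mathbb{R}^d\to\mathbb{R}$ consistent with $(x_i,f_i,g_i)_{i=0}^N$ and every minimizer $x_\star$ of $f$ with $\|x_0-x_\star\|\le D$, writing $f_\star=f(x_\star)$: $\alpha\in A_f$ and $$f_N-f_\star\ \le\ f_N-f_\star+\sigma\|z_{N+1}-x_\star\|^2\ \le\ f_N-\alpha(x_\star)+\sigma\|z_{N+1}-x_\star\|^2\ \le\ f_N-\min_{\|x-x_0\|\le D}\alpha(x)\ \le\ r_\star,$$ where, if $\nabla\alpha\ne 0$, $\sigma=\frac{\|\nabla\alpha\|}{2D}$ and $z_{N+1}=x_0-\frac{1}{2\sigma}\nabla\alpha$, and otherwise $\sigma=0$ and $z_{N+1}\in\mathbb{R}^d$ is 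arbitrary.
   Context: $\|\cdot\|$ and $\langle\cdot,\cdot\rangle$ are the Euclidean norm and inner product. A convex function $f:\mathbb{R}^d\to\mathbb{R}$ is consistent with first-order information $(x_i,f_i,g_i)_{i=0}^N$ if $f(x_i)=f_i$ and $g_i\in\partial f(x_i)$ (the convex subdifferential) for all $i=0,\dots,N$. $A_f$ is the set of affine functions $\alpha(x)=\langle a,x\rangle+b$ on $\mathbb{R}^d$ with $\alpha(x)\le f(x)$ for all $x$. For affine $\alpha$, $\nabla\alpha$ denotes its constant gradient. *)

(* Defs.v *)
From HB Require Import structures.
From mathcomp Require Import all_boot all_order all_algebra.
From mathcomp Require Import all_classical all_reals all_analysis.

Set Implicit Arguments.
Unset Strict Implicit.
Unset Printing Implicit Defensive.
Import Order.TTheory GRing.Theory Num.Theory.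
Import numFieldNormedType.Exports.

Local Open Scope classical_set_scope.
Local Open Scope ring_scope.

Definition inner (R : realType) (d : nat) (u v : 'rV[R]_d) : R :=
  \sum_(i < d) u ord0 i * v ord0 i.

(* The norm [`|u|] that the library puts on ['rV[R]_d] is the sup norm. *)
Definition enorm (R : realType) (d : nat) (u : 'rV[R]_d) : R :=
  Num.sqrt (inner u u).

Definition is_maximum (R : realType) (A : set R) (m : R) : Prop :=
  A m /\ ubound A m.

Definition is_minimum (R : realType) (A : set R) (m : R) : Prop :=
  A m /\ lbound A m.

Definition minimizer (R : realType) (d : nat) (f : 'rV[R]_d -> R)
    (xs : 'rV[R]_d) : Prop :=
  forall y, f xs <= f y.

Definition cball (R : realType) (d : nat) (c : 'rV[R]_d) (D : R) :
    set 'rV[R]_d :=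
  [set x | enorm (x - c) <= D].

Definition subdifferential (R : realType) (d : nat) (f : 'rV[R]_d -> R)
    (x : 'rV[R]_d) : set 'rV[R]_d :=
  [set g | forall y, f x + inner g (y - x) <= f y].

Definition consistent (R : realType) (d N : nat) (f : 'rV[R]_d -> R)
    (x : 'I_N.+1 -> 'rV[R]_d) (fv : 'I_N.+1 -> R)
    (g : 'I_N.+1 -> 'rV[R]_d) : Prop :=
  forall i, f (x i) = fv i /\ subdifferential f (x i) (g i).

Definition affine_minorants (R : realType) (d : nat) (f : 'rV[R]_d -> R) :
    set ('rV[R]_d -> R) :=
  [set al | (exists (a : 'rV[R]_d) (b : R), forall x, al x = inner a x + b)
            /\ forall x, al x <= f x].

(* Frechet derivative; all norms on ['rV[R]_d] being equivalent, it does not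
   matter that the library computes it with the sup norm. *)
Definition is_gradient (R : realType) (d : nat) (f : 'rV[R]_d -> R)
    (x G : 'rV[R]_d) : Prop :=
  is_diff x (f : 'rV[R]_d -> R^o) (inner G : 'rV[R]_d -> R^o).

Definition gap_values (R : realType) (d N : nat) (D : R)
    (x : 'I_N.+1 -> 'rV[R]_d) (fv : 'I_N.+1 -> R)
    (g : 'I_N.+1 -> 'rV[R]_d) : set R :=
  [set r | exists (xs : 'rV[R]_d) (fs : R),
    [/\ 0 <= D ^+ 2 - enorm (x ord0 - xs) ^+ 2,
        forall i, 0 <= fs - fv i - inner (g i) (xs - x i),
        forall i, 0 <= fv i - fs
      & r = fv ord_max - fs]].

Definition aggregate (R : realType) (d N : nat) (a : 'I_N.+1 -> R)
    (x : 'I_N.+1 -> 'rV[R]_d) (fv : 'I_N.+1 -> R)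
    (g : 'I_N.+1 -> 'rV[R]_d) : 'rV[R]_d -> R :=
  fun y => \sum_(i < N.+1) a i * (fv i + inner (g i) (y - x i)).

(* Main.v *)
(** By strong duality for the problem defining [r_star], its optimal dual
multipliers are the weights.  The value [f_N - r_star] is the minimum over the
ball of the maximum of the cuts [l_i(y) = f_i + <g_i, y - x_i>]; the
constraints [f_star <= f_i] are inactive because the given minimizer has cuts
below its function value.  The minimum over the ball of [sum_i a_i l_i] is
[<a, c> - D |sum_i a_i g_i|] with [c_i = l_i(x_0)], and the weights maximize
this concave function over the simplex.  It fails to be differentiable where
[sum_i a_i g_i = 0], so it is smoothed to
[<a, c> - D sqrt (|sum_i a_i g_i|^2 + e^2)]: with [s] the square root, the
first-order conditions at a maximizer imply that the point
[x_0 - (D / s) sum_i a_i g_i] of the ball has all its cuts below the dual value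
up to [D e], and [e] is arbitrary. *)

Require Import Defs.
From HB Require Import structures.
From mathcomp Require Import all_boot all_order all_algebra.
From mathcomp Require Import all_classical all_reals all_analysis.
From mathcomp Require Import ring lra.

Set Implicit Arguments.
Unset Strict Implicit.
Unset Printing Implicit Defensive.
Import Order.TTheory GRing.Theory Num.Theory.
Import numFieldNormedType.Exports.

Local Open Scope classical_set_scope.
Local Open Scope ring_scope.

(** * Euclidean inner product and norm: Cauchy-Schwarz, continuity, gradients of affine maps,
    compact balls *)

Section Euclidean.
Variables (R : realType) (d : nat).
Implicit Types (u v w : 'rV[R]_d) (k : R).

Lemma innerC u v : inner u v = inner v u.
Proof. by apply: eq_bigr => i _; rewrite mulrC. Qed.

Lemma innerDl u v w : inner (u + v) w = inner u w + inner v w.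
Proof.
by rewrite -big_split; apply: eq_bigr => i _; rewrite mxE mulrDl.
Qed.

Lemma innerZl k u v : inner (k *: u) v = k * inner u v.
Proof.
by rewrite /inner mulr_sumr; apply: eq_bigr => i _; rewrite mxE mulrA.
Qed.

Lemma innerDr u v w : inner u (v + w) = inner u v + inner u w.
Proof. by rewrite innerC innerDl !(innerC u). Qed.

Lemma innerZr k u v : inner u (k *: v) = k * inner u v.
Proof. by rewrite innerC innerZl innerC. Qed.

Lemma innerNl u v : inner (- u) v = - inner u v.
Proof. by rewrite -scaleN1r innerZl mulN1r. Qed.

Lemma innerNr u v : inner u (- v) = - inner u v.
Proof. by rewrite innerC innerNl innerC. Qed.

Lemma inner0l v : inner 0 v = 0.
Proof. by rewrite -(scale0r (0 : 'rV_d)) innerZl mul0r. Qed.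

Lemma inner_suml (I : finType) (F : I -> 'rV[R]_d) v :
  inner (\sum_i F i) v = \sum_i inner (F i) v.
Proof.
by apply: (big_morph (fun u => inner u v)) => [u w|];
  [rewrite innerDl | rewrite inner0l].
Qed.

Lemma inner_ge0 u : 0 <= inner u u.
Proof. by apply: sumr_ge0 => i _; rewrite -expr2 sqr_ge0. Qed.

Lemma inner_eq0 u : (inner u u == 0) = (u == 0).
Proof.
apply/idP/idP => [|/eqP ->]; last by rewrite inner0l.
rewrite psumr_eq0 => [/allP u0|i _]; last by rewrite -expr2 sqr_ge0.
apply/eqP/rowP => i; rewrite mxE; apply/eqP.
by have := u0 i (mem_index_enum i); rewrite -expr2 sqrf_eq0.
Qed.

Lemma enorm_ge0 u : 0 <= enorm u.
Proof. exact: sqrtr_ge0. Qed.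

Lemma enorm_sqr u : enorm u ^+ 2 = inner u u.
Proof. by rewrite sqr_sqrtr// inner_ge0. Qed.

Lemma enorm_eq0 u : (enorm u == 0) = (u == 0).
Proof. by rewrite -inner_eq0 -enorm_sqr sqrf_eq0. Qed.

Lemma enormZ k u : enorm (k *: u) = `|k| * enorm u.
Proof.
by rewrite /enorm innerZl innerZr mulrA -expr2 sqrtrM ?sqr_ge0// sqrtr_sqr.
Qed.

Lemma enormN u : enorm (- u) = enorm u.
Proof. by rewrite -scaleN1r enormZ normrN1 mul1r. Qed.

Lemma enorm_distC u v : enorm (u - v) = enorm (v - u).
Proof. by rewrite -enormN opprB. Qed.

Lemma Cauchy_Schwarz u v : `|inner u v| <= enorm u * enorm v.
Proof.
have [->|v0] := eqVneq v 0.
  by rewrite innerC inner0l normr0 mulr_ge0 ?enorm_ge0.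
rewrite -ler_sqr ?nnegrE ?mulr_ge0 ?enorm_ge0// exprMn !enorm_sqr.
rewrite real_normK ?num_real//.
have v_gt0 : 0 < inner v v by rewrite lt_neqAle eq_sym inner_eq0 v0 inner_ge0.
(* This vector is [inner v v] times the component of [u] orthogonal to [v]; its squared norm factors
   as [q * (r * q - p ^+ 2)]. *)
have := inner_ge0 (inner v v *: u - inner u v *: v).
rewrite !(innerDl, innerDr, innerNl, innerNr, innerZl, innerZr) (innerC v u).
set p := inner u v; set q := inner v v in v_gt0 *; set r := inner u u.
move=> h; have : 0 <= q * (r * q - p ^+ 2) by lra.
by rewrite pmulr_rge0// subr_ge0.
Qed.

Lemma enorm_coord u i : `|u ord0 i| <= enorm u.
Proof.
rewrite -ler_sqr ?nnegrE ?enorm_ge0// enorm_sqr real_normK ?num_real//.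
rewrite /inner (bigD1 i)//= -expr2 lerDl.
by apply: sumr_ge0 => j _; rewrite -expr2 sqr_ge0.
Qed.

Lemma inner_linear u : linear (inner u : 'rV[R]_d -> R^o).
Proof. by move=> k v w; rewrite innerDr innerZr. Qed.

Lemma continuous_inner (T : topologicalType) (p q : T -> 'rV[R]_d) :
  continuous p -> continuous q -> continuous (fun t => inner (p t) (q t)).
Proof.
move=> cp cq; apply: (@continuous_big R^o) => [|i _]; first exact: add_continuous.
have coord (r : T -> 'rV[R]_d) :
    continuous r -> continuous (fun t => r t ord0 i).
  move=> cr t.
  exact: (continuous_comp (cr t) (@coord_continuous R 1 d ord0 i (r t))).
by move=> t; apply: (@continuousM _ T); exact: coord.
Qed.

Lemma continuous_enorm (T : topologicalType) (p : T -> 'rV[R]_d) :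
  continuous p -> continuous (fun t => enorm (p t)).
Proof.
move=> cp t; apply: (@continuous_comp T R^o R^o); last exact: sqrt_continuous.
exact: continuous_inner.
Qed.

Lemma is_gradient_affine (f : 'rV[R]_d -> R) (u : 'rV[R]_d) (b : R) :
  (forall y, f y = inner u y + b) -> forall y, is_gradient f y u.
Proof.
move=> fE y.
have cu : continuous (inner u : 'rV[R]_d -> R^o).
  by apply: (@continuous_inner _ (fun=> u) (fun z => z)) => z;
    [exact: cst_continuous | exact: cvg_id].
pose L : {linear 'rV[R]_d -> R^o} :=
  HB.pack (inner u : 'rV[R]_d -> R^o)
    (GRing.isLinear.Build R 'rV[R]_d R^o *:%R (inner u) (inner_linear u)).
have dL : is_diff y (inner u : 'rV[R]_d -> R^o) (inner u : 'rV[R]_d -> R^o).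
  by apply: DiffDef; [exact: (@linear_differentiable _ _ _ L)
                     | exact: (@diff_lin _ _ _ L)].
have -> : f = (inner u : 'rV[R]_d -> R^o) + cst b.
  by apply/funext => z; rewrite fE.
have := is_diffD dL (is_diff_cst (b : R^o) y).
by rewrite addr0.
Qed.

(** The ball is closed and sits inside a box, which is a finite product of segments. *)
Lemma compact_cball (c : 'rV[R]_d) (D : R) : compact (cball c D).
Proof.
pose B := [set v : 'rV[R]_d |
  forall i, `[c ord0 i - D, c ord0 i + D]%classic (v ord0 i)].
apply: (@subclosed_compact _ _ B).
- have -> : cball c D =
    (fun z => enorm (z - c) : R) @^-1` [set r | r <= D] by [].
  apply: preimage_closed; last exact: closed_le.
  move=> z _; apply: continuous_enorm => {}z.
  by apply: continuousB; [exact: cvg_id | exact: cst_continuous].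
- apply: (@rV_compact _ _ (fun i => `[c ord0 i - D, c ord0 i + D]%classic)) => i.
  exact: segment_compact.
- move=> v vD i; rewrite /= in_itv/= -ler_distl.
  by apply: le_trans vD; have := enorm_coord (v - c) i; rewrite !mxE.
Qed.

End Euclidean.

(** Replaces letting the step [t] tend to 0 in a first-order perturbation argument. If [X] were
    positive, the admissible step [X / (X + Q)] would give [X * X <= 0]. *)
Lemma le0_of_le_scale (R : realType) (X Q : R) : 0 <= Q ->
  (forall t, 0 < t -> t <= 1 -> X <= t * Q) -> X <= 0.
Proof.
move=> Q0 XQ; rewrite leNgt; apply/negP => X0.
have XQ0 : 0 < X + Q by lra.
have := XQ (X / (X + Q)); rewrite divr_gt0// ler_pdivrMr// mul1r lerDl Q0.
move=> /(_ isT isT); rewrite mulrAC ler_pdivlMr// mulrDr.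
by have := mulr_gt0 X0 X0; lra.
Qed.

(** * Strong duality between the maximum of affine functions on a ball and their convex
    combinations *)

Section Minimax.
Variables (R : realType) (d N : nat) (D : R).
Variables (c : 'I_N.+1 -> R) (g : 'I_N.+1 -> 'rV[R]_d).
Hypothesis D_gt0 : 0 < D.

Let V (a : 'rV[R]_N.+1) : 'rV[R]_d := \sum_i a ord0 i *: g i.
Let C (a : 'rV[R]_N.+1) : R := \sum_i a ord0 i * c i.
Let simplex : set 'rV[R]_N.+1 :=
  [set a | (forall i, 0 <= a ord0 i) /\ \sum_i a ord0 i = 1].
(** The smoothed dual function; [e = 0] gives back the true dual function. *)
Let phi (e : R) (a : 'rV[R]_N.+1) : R :=
  C a - D * Num.sqrt (inner (V a) (V a) + e ^+ 2).

Let continuous_V : continuous V.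
Proof.
apply: continuous_big => [|i _]; first exact: add_continuous.
move=> a; apply: (@continuousZ _ _ _ (fun a : 'rV[R]_N.+1 => a ord0 i : R^o)
  (fun=> g i)); [exact: coord_continuous | exact: cst_continuous].
Qed.

Let continuous_phi e : continuous (phi e).
Proof.
move=> a; apply: (@continuousB _ R^o).
  apply: (@continuous_big R^o) => [|i _ {}a]; first exact: add_continuous.
  apply: (@continuousM _ 'rV[R]_N.+1); first exact: coord_continuous.
  exact: cst_continuous.
apply: (@continuousM _ 'rV[R]_N.+1); first exact: cst_continuous.
apply: (@continuous_comp _ R^o R^o); last exact: sqrt_continuous.
apply: (@continuousD _ R^o); last exact: cst_continuous.
exact: continuous_inner.
Qed.

Let compact_simplex : compact simplex.
Proof.
pose B := [set v : 'rV[R]_N.+1 | forall i, `[0 : R, 1]%classic (v ord0 i)].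
apply: (@subclosed_compact _ _ B).
- have -> : simplex = (\bigcap_i ((fun a : 'rV[R]_N.+1 => a ord0 i) @^-1`
                                     [set r | 0 <= r])) `&`
                  ((fun a : 'rV[R]_N.+1 => \sum_i a ord0 i) @^-1`
                     [set r | r = 1]).
    apply/seteqP; split=> a /= [a0 a1]; split=> // i.
      by move=> _; exact: a0.
    exact: (a0 i I).
  apply: closedI.
    apply: closed_bigI => i _; apply: preimage_closed; last exact: closed_ge.
    by move=> a _; exact: coord_continuous.
  apply: preimage_closed; last exact: closed_eq.
  move=> a _; apply: (@continuous_big R^o) => [|i _]; first exact: add_continuous.
  exact: coord_continuous.
- apply: (@rV_compact _ _ (fun=> `[0 : R, 1]%classic)) => i.
  exact: segment_compact.
- move=> a [a0 a1] i /=; rewrite in_itv/= a0/= -a1 (bigD1 i)//= lerDl.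
  by apply: sumr_ge0.
Qed.

Let phi_max e :
  exists2 a, simplex a & forall b, simplex b -> phi e b <= phi e a.
Proof.
have [|a] := @EVT_max_rV R _ (phi e) simplex _ compact_simplex
  (continuous_subspaceT (@continuous_phi e)).
  (* A vertex witnesses that the simplex is nonempty. *)
  exists (delta_mx ord0 ord0); split=> [i|]; first by rewrite mxE ler0n.
  rewrite (bigD1 ord0)//= mxE !eqxx big1 ?addr0// => i /negPf i0.
  by rewrite mxE i0 andbF.
rewrite inE => sa amax; exists a => // b sb.
by apply: amax; rewrite inE.
Qed.

(** At a maximizer, the derivative of [phi e] along the segment from [a] to the vertex [i] is
    nonpositive; this is that condition multiplied by the square root. *)
Let smoothed_optimality e a i : 0 < e -> simplex a ->
    (forall b, simplex b -> phi e b <= phi e a) ->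
  Num.sqrt (inner (V a) (V a) + e ^+ 2) * (c i - C a)
    <= D * inner (V a) (g i - V a).
Proof.
move=> e0 [a0 a1] amax; set s := Num.sqrt _.
have s2 : s ^+ 2 = inner (V a) (V a) + e ^+ 2.
  by rewrite sqr_sqrtr// addr_ge0 ?inner_ge0 ?sqr_ge0.
set w := g i - V a.
suff : 2 * (s * (c i - C a) - D * inner (V a) w) <= 0 by lra.
(* The bound [D * inner w w] comes from the term of second order in [t] in the squared norm of
   [V b]. *)
apply: (@le0_of_le_scale _ _ (D * inner w w)) => [|t t0 t1].
  by rewrite mulr_ge0 ?inner_ge0// ltW.
pose b := (1 - t) *: a + t *: delta_mx ord0 i.
have bE j : b ord0 j = (1 - t) * a ord0 j +
    t * (delta_mx ord0 i : 'rV[R]_N.+1) ord0 j.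
  by rewrite mxE; congr (_ + _); rewrite mxE.
have sumdelta (F : 'I_N.+1 -> R) :
    \sum_j (delta_mx ord0 i : 'rV[R]_N.+1) ord0 j * F j = F i.
  rewrite (bigD1 i)//= mxE !eqxx mul1r big1 ?addr0// => j /negPf ji.
  by rewrite mxE ji andbF mul0r.
have sb : simplex b.
  split=> [j|].
    by rewrite !mxE addr_ge0// mulr_ge0 ?ler0n ?subr_ge0// ltW.
  under eq_bigr do rewrite bE.
  rewrite big_split/= -!mulr_sumr a1.
  have := sumdelta (fun=> 1); under eq_bigr do rewrite mulr1.
  by move=> ->; ring.
have Vb : V b = V a + t *: w.
  rewrite /V; under eq_bigr do rewrite bE scalerDl -!scalerA.
  rewrite big_split/= -!scaler_sumr.
  have -> : \sum_j (delta_mx ord0 i : 'rV[R]_N.+1) ord0 j *: g j = g i.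
    rewrite (bigD1 i)//= mxE !eqxx scale1r big1 ?addr0// => j /negPf ji.
    by rewrite mxE ji andbF scale0r.
  by rewrite /w scalerBr scalerBl scale1r addrA addrAC.
clearbody w.
have Cb : C b = C a + t * (c i - C a).
  rewrite /C; under eq_bigr do rewrite bE mulrDl -!mulrA.
  by rewrite big_split/= -!mulr_sumr sumdelta; ring.
have := amax b sb; rewrite /phi -/s Cb.
set S := Num.sqrt (inner (V b) _ + _).
have S2 : S ^+ 2 = s ^+ 2 + t * (2 * inner (V a) w + t * inner w w).
  rewrite sqr_sqrtr ?addr_ge0 ?inner_ge0 ?sqr_ge0// s2 Vb.
  by rewrite !(innerDl, innerDr, innerZl, innerZr) (innerC w); ring.
have s0 : 0 <= s by exact: sqrtr_ge0.
(* AM-GM, [2 s S <= s^2 + S^2], linearizes the square root. *)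
have sq := mulr_ge0 (ltW D_gt0) (sqr_ge0 (S - s)).
move=> ineq.
have sq' : 2 * s * (D * (S - s)) <=
    D * (t * (2 * inner (V a) w + t * inner w w)).
  by rewrite -subr_ge0; move: sq; rewrite sqrrB S2; lra.
have ineq' : 2 * s * (t * (c i - C a)) <= 2 * s * (D * (S - s)).
  by apply: ler_wpM2l; [rewrite mulr_ge0 | lra].
by rewrite -(ler_pM2l t0); lra.
Qed.

(** The nontrivial half of duality. The weights maximize the true dual function, so they are fixed
    before [m] and before any smoothing; maximizers of the smoothed functions serve only as
    comparison points. *)
Lemma affine_minimax : exists a : 'I_N.+1 -> R,
  [/\ forall i, 0 <= a i, \sum_i a i = 1
    & forall m,
      (forall y, enorm y <= D -> exists i, m <= c i + inner (g i) y) ->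
      m <= \sum_i a i * c i - D * enorm (\sum_i a i *: g i)].
Proof.
have [a0 [a0_ge0 a0_sum] a0_max] := phi_max 0.
exists (a0 ord0); split=> // m hm.
apply/ler_addgt0Pr => e' e'0.
(* Scaled so that the smoothing loss [D * e] is exactly [e']. *)
pose e := e' / D; have e0 : 0 < e by rewrite divr_gt0.
have [a sa amax] := phi_max e.
set s := Num.sqrt (inner (V a) (V a) + e ^+ 2).
have s2 : s ^+ 2 = inner (V a) (V a) + e ^+ 2.
  by rewrite sqr_sqrtr// addr_ge0 ?inner_ge0 ?sqr_ge0.
have es : e <= s.
  have : Num.sqrt (e ^+ 2) <= s by rewrite ler_wsqrtr// lerDr inner_ge0.
  by rewrite sqrtr_sqr ger0_norm// ltW.
have vs : enorm (V a) <= s by rewrite /enorm ler_wsqrtr// lerDl sqr_ge0.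
have s0 : 0 < s by lra.
(* Dividing by [s] rather than by [enorm (V a)] keeps the point in the ball and makes sense even
   when [V a = 0]. *)
have [|i mi] := hm (- (D / s) *: V a).
  rewrite enormZ normrN ger0_norm; last by rewrite ltW// divr_gt0.
  by rewrite mulrAC ler_pdivrMr// ler_pM2l.
have opt := smoothed_optimality i e0 sa amax; rewrite -/s /= in opt.
have phi0 : phi 0 a0 = \sum_i a0 ord0 i * c i - D * enorm (V a0).
  by rewrite /phi expr0n/= addr0.
have := a0_max a sa; rewrite phi0 {1}/phi expr0n/= addr0 -/(enorm (V a)) => le0.
(* The middle term is [phi e a + e']: it is below [phi 0 a + e'], hence below [phi 0 a0 + e']. The
   optimality condition bounds [m] by it. *)
apply: (@le_trans _ _ (C a - D * s + e')); last first.
  have := ler_wpM2l (ltW D_gt0) vs; rewrite -/(V a0); lra.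
apply: le_trans mi _; rewrite innerZr.
rewrite innerDr innerNr in opt.
have e'E : e' = D * e by rewrite /e mulrCA divff ?mulr1// gt_eqF.
rewrite -(ler_pM2l s0) e'E.
have -> : s * (c i + - (D / s) * inner (g i) (V a)) =
    s * c i - D * inner (g i) (V a).
  by field; rewrite gt_eqF.
(* After multiplication by [s], the optimality condition leaves the error [D * (e * e)], which
   [e <= s] absorbs into [s * (D * e)]. *)
have : D * (e * e) <= D * (e * s) by rewrite !ler_pM2l.
have VE : inner (V a) (V a) = s ^+ 2 - e ^+ 2 by rewrite s2; ring.
rewrite VE in opt.
rewrite innerC in opt.
by lra.
Qed.

End Minimax.

Lemma sub_sqr_ge0 (R : realType) (D r : R) : 0 <= D -> 0 <= r ->
  (0 <= D ^+ 2 - r ^+ 2) = (r <= D).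
Proof. by move=> D0 r0; rewrite subr_ge0 ler_sqr. Qed.

(** * Cuts, their aggregates, and attainment in the problem defining [rstar] *)

Section AffineMinorants.
Variables (R : realType) (d N : nat) (D : R).
Variables (x : 'I_N.+1 -> 'rV[R]_d) (fv : 'I_N.+1 -> R).
Variable g : 'I_N.+1 -> 'rV[R]_d.
Hypothesis D_gt0 : 0 < D.

Definition cut i y : R := fv i + inner (g i) (y - x i).

Lemma cut_shift i y z : cut i y = cut i z + inner (g i) (y - z).
Proof. by rewrite /cut !(innerDr, innerNr); ring. Qed.

Lemma cut_le f i y : consistent f x fv g -> cut i y <= f y.
Proof. by move=> /(_ i); rewrite /cut => -[<-]; apply. Qed.

(** Recentring every cut at the same [z] exposes the gradient [\sum_i a i *: g i]. *)
Lemma aggregateE (a : 'I_N.+1 -> R) y z :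
  aggregate a x fv g y =
  \sum_i a i * cut i z + inner (\sum_i a i *: g i) (y - z).
Proof.
rewrite inner_suml -big_split; apply: eq_bigr => i _.
by rewrite /= innerZl -mulrDr -cut_shift.
Qed.

Lemma aggregate_le (a : 'I_N.+1 -> R) f y :
  (forall i, 0 <= a i) -> \sum_i a i = 1 -> consistent f x fv g ->
  aggregate a x fv g y <= f y.
Proof.
move=> a0 a1 fc; rewrite -[leRHS]mul1r -a1 mulr_suml.
by apply: ler_sum => i _; apply: ler_wpM2l => //; exact: cut_le.
Qed.

(** Cauchy-Schwarz gives the lower bound, with equality at distance [D] from the centre against the
    gradient. *)
Lemma is_minimum_affine_cball (f : 'rV[R]_d -> R) (b : R) (c u : 'rV[R]_d) :
  (forall y, f y = b + inner u (y - c)) ->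
  is_minimum (f @` cball c D) (b - D * enorm u).
Proof.
move=> fE; split=> [|_ [y yD <-]]; last first.
  rewrite fE lerD2l; have := Cauchy_Schwarz u (y - c).
  rewrite ler_norml => /andP[+ _]; apply: le_trans.
  by rewrite lerN2 mulrC ler_wpM2r// enorm_ge0.
(* For [u = 0] the quotient is 0 by convention and the point is the centre, which is then a
   minimizer too. *)
exists (c - (D / enorm u) *: u).
  rewrite /cball /= addrC addKr enormN enormZ ger0_norm; last first.
    by rewrite divr_ge0 ?enorm_ge0// ltW.
  have [->|u0] := eqVneq (enorm u) 0; first by rewrite mulr0 ltW.
  by rewrite divfK.
rewrite fE [c - _]addrC addrK innerNr innerZr -enorm_sqr; congr (_ - _).
have [->|u0] := eqVneq (enorm u) 0; first by rewrite expr0n/= !mulr0.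
by rewrite expr2 mulrA divfK.
Qed.

(** The default value is itself one of the cuts, so it does not alter the maximum. *)
Definition cut_max y : R := \big[Num.max/cut ord0 y]_i cut i y.

Lemma le_cut_max i y : cut i y <= cut_max y.
Proof. exact: le_bigmax. Qed.

Lemma cut_max_le y (r : R) : (forall i, cut i y <= r) -> cut_max y <= r.
Proof. by move=> h; apply: bigmax_le. Qed.

Lemma cut_max_attained y : exists i, cut_max y = cut i y.
Proof.
apply: (big_ind (fun r => exists i, r = cut i y)); first by exists ord0.
  by move=> _ _ [i ->] [j ->]; have [_|_] := leP (cut i y);
    [exists j | exists i].
by move=> i _; exists i.
Qed.

Lemma continuous_cut i : continuous (cut i).
Proof.
move=> y; apply: (@continuousD _ R^o _ (fun=> fv i)
  (fun y : 'rV[R]_d => inner (g i) (y - x i))); first exact: cst_continuous.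
apply: (@continuous_inner _ _ _ (fun=> g i) (fun y : 'rV[R]_d => y - x i)) => z.
  exact: cst_continuous.
by apply: continuousB; [exact: cvg_id | exact: cst_continuous].
Qed.

Lemma continuous_cut_max : continuous cut_max.
Proof.
rewrite /cut_max; elim: index_enum => [|i r ih] y.
  by under eq_fun do rewrite big_nil; exact: continuous_cut.
under eq_fun do rewrite big_cons.
by apply: continuous_max; [exact: continuous_cut | exact: ih].
Qed.

(** For a fixed point, [cut_max] is the least value the cut constraints allow for [fs], so the
    problem amounts to minimizing [cut_max] over a compact ball. *)
Lemma gap_values_max f (xs : 'rV[R]_d) :
    consistent f x fv g -> minimizer f xs -> enorm (x ord0 - xs) <= D ->
  exists m, is_maximum (gap_values D x fv g) (fv ord_max - m) /\
    forall y, cball (x ord0) D y -> m <= cut_max y.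
Proof.
move=> fc fmin xsD.
have xs_in : cball (x ord0) D xs by rewrite /cball /= enorm_distC.
have [|y] := @EVT_min_rV R _ cut_max (cball (x ord0) D) _
  (@compact_cball _ _ _ _) (continuous_subspaceT continuous_cut_max).
  by exists xs.
rewrite inE => yD ymin.
exists (cut_max y); split; last by move=> z zD; apply: ymin; rewrite inE.
split=> [|_ [z [r [zD zr _ ->]]]].
  exists y, (cut_max y); split=> // [|i|i].
  - by rewrite (sub_sqr_ge0 (ltW D_gt0)) ?enorm_ge0// enorm_distC.
  - by rewrite -addrA -opprD subr_ge0; exact: le_cut_max.
  (* The chain is [cut_max y <= cut_max xs <= f xs <= f (x i) = fv i], using that [xs] lies in the
     ball and minimizes [f]. *)
  - rewrite subr_ge0; apply: (@le_trans _ _ (cut_max xs)).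
      by apply: ymin; rewrite inE.
    apply: (@le_trans _ _ (f xs)); first by apply: cut_max_le => j; exact: cut_le.
    by have [<- _] := fc i; exact: fmin.
rewrite lerD2l lerN2; apply: (@le_trans _ _ (cut_max z)).
  apply: ymin; rewrite inE /cball /= enorm_distC.
  by rewrite -(sub_sqr_ge0 (ltW D_gt0)) ?enorm_ge0.
by apply: cut_max_le => i; have := zr i; rewrite -addrA -opprD subr_ge0.
Qed.

End AffineMinorants.

(** For nonzero [u], expanding the square gives [s * enorm (c - y) ^+ 2 + inner u (y - c) + s * D ^+
    2]. The ball bounds the first term by [s * D ^+ 2], and the choice of [s] makes [2 * s * D ^+ 2]
    equal to [D * enorm u]. *)
Lemma prox_step_le (R : realType) (d : nat) (D s : R) (u c z y : 'rV[R]_d) :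
    0 < D -> enorm (c - y) <= D ->
    (if u == 0 then s = 0
     else s = enorm u / (2 * D) /\ z = c - (1 / (2 * s)) *: u) ->
  0 <= s /\ s * enorm (z - y) ^+ 2 <= inner u (y - c) + D * enorm u.
Proof.
move=> D0 yD; case: eqVneq => [-> ->|u0 [sE ->]].
  by rewrite mul0r inner0l add0r (mulr_ge0 (ltW D0)) ?enorm_ge0 ?lexx.
have u_gt0 : 0 < enorm u by rewrite lt_neqAle eq_sym enorm_eq0 u0 enorm_ge0.
have s0 : 0 < s by rewrite sE divr_gt0// mulr_gt0.
split; first exact: ltW.
have uE : enorm u = 2 * D * s.
  by rewrite sE; field; rewrite gt_eqF.
have -> : c - (1 / (2 * s)) *: u - y = (c - y) - (1 / (2 * s)) *: u.
  by rewrite addrAC.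
rewrite -(opprB c y) enorm_sqr; set w := c - y in yD *; clearbody w.
rewrite innerNr !(innerDl, innerDr, innerNl, innerNr, innerZl, innerZr).
rewrite (innerC w) -!enorm_sqr uE.
have : s * enorm w ^+ 2 <= s * D ^+ 2.
  by rewrite ler_pM2l// ler_sqr ?nnegrE ?enorm_ge0// ltW.
set p := inner u w; set q := enorm w ^+ 2.
move=> sD; rewrite (_ : s * _ = s * q - p + s * D ^+ 2); first by lra.
by field; rewrite gt_eqF.
Qed.

Theorem theorem4p1 (R : realType) (d N : nat) (D : R)
    (x : 'I_N.+1 -> 'rV[R]_d) (fv : 'I_N.+1 -> R) (g : 'I_N.+1 -> 'rV[R]_d)
    (D_gt0 : 0 < D)
    (info : exists h : 'rV[R]_d -> R,
       [/\ convex_function setT h, consistent h x fv g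
         & exists hs : 'rV[R]_d, minimizer h hs /\ enorm (x ord0 - hs) <= D]) :
  exists rstar : R, is_maximum (gap_values D x fv g) rstar /\
  exists a : 'I_N.+1 -> R,
    [/\ forall i, 0 <= a i,
        \sum_(i < N.+1) a i = 1
      & let alpha := aggregate a x fv g in
        exists (nabla : 'rV[R]_d) (amin : R),
        [/\ forall y, is_gradient alpha y nabla,
            is_minimum (alpha @` cball (x ord0) D) amin
          & forall (f : 'rV[R]_d -> R) (xs : 'rV[R]_d),
            convex_function setT f -> consistent f x fv g ->
            minimizer f xs -> enorm (x ord0 - xs) <= D ->
            affine_minorants f alpha /\
            forall (sigma : R) (z : 'rV[R]_d),
              (if nabla == 0 then sigma = 0
               else sigma = enorm nabla / (2 * D) /\
                    z = x ord0 - (1 / (2 * sigma)) *: nabla) ->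
              [/\ fv ord_max - f xs
                    <= fv ord_max - f xs + sigma * enorm (z - xs) ^+ 2,
                  fv ord_max - f xs + sigma * enorm (z - xs) ^+ 2
                    <= fv ord_max - alpha xs + sigma * enorm (z - xs) ^+ 2,
                  fv ord_max - alpha xs + sigma * enorm (z - xs) ^+ 2
                    <= fv ord_max - amin
                & fv ord_max - amin <= rstar]]].
Proof.
have [h [_ hc [hs [hmin hsD]]]] := info.
have [m [m_max m_le]] := gap_values_max D_gt0 hc hmin hsD.
exists (fv ord_max - m); split=> //.
(* The weights depend only on the cuts and [D], and are chosen before any [f], so they serve all
   consistent functions at once. *)
have [a [a0 a1 a_dual]] :=
  affine_minimax (fun i => cut x fv g i (x ord0)) g D_gt0.
exists a; split=> // alpha.
set u := \sum_i a i *: g i in a_dual.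
set b := \sum_i a i * _ in a_dual.
have alphaE y : alpha y = b + inner u (y - x ord0) by exact: aggregateE.
have alpha_affine y : alpha y = inner u y + (b - inner u (x ord0)).
  by rewrite alphaE innerDr innerNr; ring.
exists u, (b - D * enorm u); split.
- exact: is_gradient_affine alpha_affine.
- exact: is_minimum_affine_cball.
move=> f xs _ fc fmin xsD.
have alpha_le y : alpha y <= f y by exact: aggregate_le.
split; first by split=> //; exists u, (b - inner u (x ord0)).
move=> s z /(prox_step_le D_gt0 xsD)[s0 step].
(* At each point of the ball the largest cut is at least [m], so duality applies after translating
   the centre [x ord0] to the origin. *)
have m_amin : m <= b - D * enorm u.
  apply: a_dual => y yD.
  have [i iE] := cut_max_attained x fv g (x ord0 + y).
  exists i; have := m_le (x ord0 + y).
  rewrite /cball /= iE (cut_shift _ _ _ _ _ (x ord0)) addrAC subrr add0r.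
  exact.
split.
- by rewrite lerDl mulr_ge0// sqr_ge0.
- by rewrite lerD2r lerD2l lerN2.
- by rewrite alphaE; lra.
- by rewrite lerD2l lerN2.
Qed.
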